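(* Every admissible mesh $\mathcal G\in\mathbb A^{p,q}$ is analysis-suitable, i.e. no horizontal T-junction extension in $\mathcal G$ intersects a vertical T-junction extension in $\mathcal G$.
   Context: Fix integers $p,q\ge 2$ (polynomial degrees) and positive integers $M,N$. Initial mesh: $\mathcal G_0=\{[m-1,m]\times[n-1,n]\mid 1\le m\le M,\ 1\le n\le N\}$, and $\overline\Omega=\bigcup\mathcal G_0=[0,M]\times[0,N]$. Elements are closed axis-parallel rectangles; a mesh is a set of elements obtained from $\mathcal G_0$ by bisections as defined below. Level: $\ell(K)=-\log_2|K|$, where $|K|$ is the area of $K$. Distance: for elements $K_1,K_2$, $\operatorname{Dist}(K_1,K_2)\in\mathbb R^2$ is the componentwise absolute value of $\operatorname{mid}(K_1)-\operatorname{mid}(K_2)$, where $\operatorname{mid}$ denotes the midpoint. Inequalities between vectors are componentwise. Patch: $\mathcal G^{p,q}(K)=\{K'\in\mathcal G\mid \operatorname{Dist}(K',K)\le \mathbf D^{p,q}(\ell(K))\}$, where $\mathbf D^{p,q}(k)=2^{-k/2}\bigl(\lfloor p/2\rfloor+\tfrac12,\ \lceil q/2\rceil+\tfrac12\bigr)$ if $k$ is even and $\mathbf D^{p,q}(k)=2^{-(k+1)/2}\bigl(\lceil p/2\rceil+\tfrac12,\ 2\lfloor q/2\rfloor+1\bigr)$ if $k$ is odd. Bisection: for $K=[\mu,\mu+\tilde\mu]\times[\nu,\nu+\tilde\nu]$, $\operatorname{child}(K)$ is the pair of rectangles obtained by halving $K$ in the $x$-direction (i.e. cutting along $x=\mu+\tilde\mu/2$)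 if $\ell(K)$ is even, and by halving $K$ in the $y$-direction (cutting along $y=\nu+\tilde\nu/2$) if $\ell(K)$ is odd. For $K\in\mathcal G$, $\operatorname{bisect}(\mathcal G,K)=(\mathcal G\setminus\{K\})\cup\operatorname{child}(K)$; for $\mathcal M=\{K_1,\dots,K_J\}\subseteq\mathcal G$, $\operatorname{bisect}(\mathcal G,\mathcal M)$ is the result of successively bisecting $K_1,\dots,K_J$ (in arbitrary order). Admissibility: the bisection of $K\in\mathcal G$ is admissible if all $K'\in\mathcal G^{p,q}(K)$ satisfy $\ell(K')\ge\ell(K)$. The bisection $\operatorname{bisect}(\mathcal G,\mathcal M)$ of several elements is admissible if the elements of $\mathcal M$ can be ordered such that it is a concatenation of admissible bisections of single elements (each with respect to the current mesh). A mesh $\mathcal G$ is admissible if it is $\mathcal G_0$ or there are meshes $\mathcal G_1,\dots,\mathcal G_J=\mathcal G$ and sets $\mathcal M_j\subseteq\mathcal G_j$ such that $\mathcal G_{j+1}=\operatorname{bisect}(\mathcal G_j,\mathcal M_j)$ is an admissible bisection for $j=0,\dots,J-1$. $\mathbb A^{p,q}$ is the set of all admissible meshes. T-junctions and extensions: let $\mathcal N$ be the set of vertices (nodes) of $\mathcal G$, let $\mathrm{hSk}$ (resp. $\mathrm{vSk}$) be the union of all (closed) horizontal (resp. vertical) edges of $\mathcal G$, so that $\mathrm{hSk}\cap\mathrm{vSk}=\mathcal N$. The active region is $\mathcal{AR}=[\lceil p/2\rceil,M-\lceil p/2\rceil]\times[\lceil q/2\rceil,N-\lceil q/2\rceil]$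 and $\mathcal N_A=\mathcal N\cap\mathcal{AR}$ is the set of active nodes. For $y\in[\lceil q/2\rceil,N-\lceil q/2\rceil]$ let $\mathbf X(y)=\{z\in[0,M]\mid(z,y)\in\mathrm{vSk}\}$, and for $x\in[\lceil p/2\rceil,M-\lceil p/2\rceil]$ let $\mathbf Y(x)=\{z\in[0,N]\mid(x,z)\in\mathrm{hSk}\}$. A T-junction is an active node $T=(t_1,t_2)$ of valence three (endpoint of exactly three edges). It has type $\dashv$ (edges to the left, up and down), $\vdash$ (right, up, down), $\bot$ (up, left, right) or $\top$ (down, left, right). T-junctions of type $\dashv,\vdash$ and their extensions are called horizontal; those of type $\bot,\top$ vertical. For type $\dashv$, take the $p+1$ consecutive entries $i_{-\lfloor p/2\rfloor}<\dots<i_{\lceil p/2\rceil}$ of $\mathbf X(t_2)$ with $i_0=t_1$, and set $\operatorname{ext}_e(T)=[i_{-\lfloor p/2\rfloor},i_0]\times\{t_2\}$ (edge extension), $\operatorname{ext}_f(T)=\,]i_0,i_{\lceil p/2\rceil}]\times\{t_2\}$ (face extension), and $\operatorname{ext}(T)=\operatorname{ext}_e(T)\cup\operatorname{ext}_f(T)$ (extension). The other types are defined analogously: for $\vdash$ the edge extension consists of $\lfloor p/2\rfloor$ index intervals of $\mathbf X(t_2)$ to the right and the face extension of $\lceil p/2\rceil$ index intervals to the left; for $\bot$ (resp. $\top$) the edge extension consists of $\lfloor q/2\rfloor$ index intervals of $\mathbf Y(t_1)$ upward (resp. downward) on the line $x=t_1$, and the face extension of $\lceil q/2\rceil$ index intervals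 downward (resp. upward). A mesh is analysis-suitable if horizontal T-junction extensions do not intersect vertical T-junction extensions. *)

(* Defs.v *)
From HB Require Import structures.
From mathcomp Require Import all_boot all_order all_algebra.
From mathcomp Require Import all_classical all_reals all_analysis.

Set Implicit Arguments.
Unset Strict Implicit.
Unset Printing Implicit Defensive.

Import Order.TTheory GRing.Theory Num.Theory.

Local Open Scope classical_set_scope.
Local Open Scope ring_scope.

(* A closed axis-parallel rectangle [xl, xr] x [yl, yr], represented by its
   bounds.  All the rectangles of the meshes below are nondegenerate, so that
   they correspond one-to-one to sets of points. *)
Record rect (R : realType) := Rect { xl : R; xr : R; yl : R; yr : R }.

HB.instance Definition _ (R : realType) := gen_eqMixin (rect R).
HB.instance Definition _ (R : realType) := gen_choiceMixin (rect R).

Definition mesh (R : realType) := set (rect R).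

Definition init_mesh (R : realType) (M N : nat) : mesh R :=
  [set K | exists m n : nat,
     [/\ (1 <= m <= M)%N, (1 <= n <= N)%N &
         K = Rect (m%:R - 1) m%:R (n%:R - 1) n%:R]].

Section Elements.
Context {R : realType}.
Implicit Types (K : rect R) (G : mesh R) (k : R).

Definition area K : R := (xr K - xl K) * (yr K - yl K).

Definition level K : R := - (ln (area K) / ln 2).

(* Levels are real numbers by definition; on the meshes below they are natural
   numbers, so that a level that is not even is odd. *)
Definition even_level k : bool := k / 2 \is a Num.int.

Definition mid K : R * R := ((xl K + xr K) / 2, (yl K + yr K) / 2).

Definition Dist K1 K2 : R * R :=
  (`|(mid K1).1 - (mid K2).1|, `|(mid K1).2 - (mid K2).2|).

(* [n./2] and [uphalf n] are the floor and the ceiling of n / 2. *)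
Definition Dpq (p q : nat) k : R * R :=
  if even_level k then
    (2 `^ (- (k / 2)) * ((p./2)%:R + 2^-1),
     2 `^ (- (k / 2)) * ((uphalf q)%:R + 2^-1))
  else
    (2 `^ (- ((k + 1) / 2)) * ((uphalf p)%:R + 2^-1),
     2 `^ (- ((k + 1) / 2)) * (2 * (q./2)%:R + 1)).

Definition patch (p q : nat) G K : mesh R :=
  [set K' | [/\ G K', (Dist K' K).1 <= (Dpq p q (level K)).1 &
                      (Dist K' K).2 <= (Dpq p q (level K)).2]].

Definition child K : mesh R :=
  if even_level (level K) then
    [set Rect (xl K) ((xl K + xr K) / 2) (yl K) (yr K);
         Rect ((xl K + xr K) / 2) (xr K) (yl K) (yr K)]
  else
    [set Rect (xl K) (xr K) (yl K) ((yl K + yr K) / 2);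
         Rect (xl K) (xr K) ((yl K + yr K) / 2) (yr K)].

Definition bisect G K : mesh R := (G `\ K) `|` child K.

Definition bisect_seq G (s : seq (rect R)) : mesh R := foldl bisect G s.

Definition admissible_bisection (p q : nat) G K : Prop :=
  G K /\ forall K', patch p q G K K' -> level K <= level K'.

Fixpoint admissible_bisection_seq (p q : nat) G (s : seq (rect R)) : Prop :=
  if s is K :: s' then
    admissible_bisection p q G K /\
    admissible_bisection_seq p q (bisect G K) s'
  else True.

(* [G'] is the result of an admissible bisection of [G] at the set [MM] of
   marked elements. *)
Definition admissible_set_bisection (p q : nat) G (MM : set (rect R)) G' :=
  MM `<=` G /\
  exists s : seq (rect R),
    [/\ uniq s, [set` s] = MM, admissible_bisection_seq p q G s &
        G' = bisect_seq G s].

End Elements.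

Inductive admissible {R : realType} (p q M N : nat) : mesh R -> Prop :=
| admissible_init : admissible p q M N (init_mesh M N)
| admissible_step (G : mesh R) (MM : set (rect R)) (G' : mesh R) :
    admissible p q M N G -> admissible_set_bisection p q G MM G' ->
    admissible p q M N G'.

Section Skeleton.
Context {R : realType}.
Implicit Types (K : rect R) (G : mesh R) (A B P T : R * R).

Definition vertex K P : Prop :=
  (P.1 = xl K \/ P.1 = xr K) /\ (P.2 = yl K \/ P.2 = yr K).

Definition node G P : Prop := exists2 K, G K & vertex K P.

(* An edge is a segment on a side of some element that joins two consecutive
   nodes on that side: the sides of the elements are subdivided at the hanging
   nodes.  Edges are given by their endpoints, the left (resp. lower) one
   first. *)
Definition hedge G A B : Prop :=
  [/\ node G A, node G B, A.2 = B.2, A.1 < B.1 &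
      (exists2 K, G K & [/\ xl K <= A.1, B.1 <= xr K &
                           A.2 = yl K \/ A.2 = yr K]) /\
      (forall P, node G P -> P.2 = A.2 -> ~ (A.1 < P.1 < B.1))].

Definition vedge G A B : Prop :=
  [/\ node G A, node G B, A.1 = B.1, A.2 < B.2 &
      (exists2 K, G K & [/\ yl K <= A.2, B.2 <= yr K &
                           A.1 = xl K \/ A.1 = xr K]) /\
      (forall P, node G P -> P.1 = A.1 -> ~ (A.2 < P.2 < B.2))].

Definition hSk G : set (R * R) :=
  [set P | exists A B, [/\ hedge G A B, P.2 = A.2 & A.1 <= P.1 <= B.1]].

Definition vSk G : set (R * R) :=
  [set P | exists A B, [/\ vedge G A B, P.1 = A.1 & A.2 <= P.2 <= B.2]].

Definition edge_left G T : Prop := exists A, hedge G A T.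
Definition edge_right G T : Prop := exists B, hedge G T B.
Definition edge_down G T : Prop := exists A, vedge G A T.
Definition edge_up G T : Prop := exists B, vedge G T B.

Definition edges_at G T : set ((R * R) * (R * R)) :=
  [set e | (hedge G e.1 e.2 \/ vedge G e.1 e.2) /\ (e.1 = T \/ e.2 = T)].

Definition active_region (p q M N : nat) : set (R * R) :=
  [set P | (uphalf p)%:R <= P.1 <= M%:R - (uphalf p)%:R /\
           (uphalf q)%:R <= P.2 <= N%:R - (uphalf q)%:R].

Definition active_node (p q M N : nat) G P : Prop :=
  node G P /\ active_region p q M N P.

Definition Xindex (M : nat) G (y : R) : set R :=
  [set z | 0 <= z <= M%:R /\ vSk G (z, y)].

Definition Yindex (N : nat) G (x : R) : set R :=
  [set z | 0 <= z <= N%:R /\ hSk G (x, z)].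

(* [i (- l) < ... < i 0 = t < ... < i r] are l + r + 1 consecutive entries
   of [S]. *)
Definition consecutive_entries (S : set R) (l r : nat) (t : R) (i : int -> R) :
    Prop :=
  [/\ i 0 = t,
      (forall j : int, - l%:Z <= j <= r%:Z -> S (i j)) &
      (forall j : int, - l%:Z <= j < r%:Z ->
         i j < i (j + 1) /\ forall z, S z -> ~ (i j < z < i (j + 1)))].

End Skeleton.

(* [Tleft], [Tright], [Tup], [Tdown] stand for the types -|, |-, _|_ and T:
   the name gives the direction of the edge that is not opposite to another
   edge, which is also the direction of the edge extension. *)
Variant Ttype := Tleft | Tright | Tup | Tdown.

Definition horizontal (tau : Ttype) : bool :=
  match tau with Tleft | Tright => true | Tup | Tdown => false end.

Section TJunctions.
Context {R : realType}.
Implicit Types (G : mesh R) (T : R * R).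

Definition has_Ttype G T (tau : Ttype) : Prop :=
  match tau with
  | Tleft => [/\ edge_left G T, edge_up G T & edge_down G T]
  | Tright => [/\ edge_right G T, edge_up G T & edge_down G T]
  | Tup => [/\ edge_up G T, edge_left G T & edge_right G T]
  | Tdown => [/\ edge_down G T, edge_left G T & edge_right G T]
  end.

Definition Tjunction (p q M N : nat) G T (tau : Ttype) : Prop :=
  [/\ active_node p q M N G T, (edges_at G T #= `I_3)%card & has_Ttype G T tau].

(* The entries required by [consecutive_entries] exist for every T-junction of
   a mesh refining the initial mesh, since all the lines of the latter remain
   in the skeleton. *)
Definition ext_e (p q M N : nat) G T (tau : Ttype) : set (R * R) :=
  match tau with
  | Tleft => [set P | P.2 = T.2 /\ exists2 i,
      consecutive_entries (Xindex M G T.2) p./2 (uphalf p) T.1 i &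
      i (- (p./2)%:Z) <= P.1 <= i 0]
  | Tright => [set P | P.2 = T.2 /\ exists2 i,
      consecutive_entries (Xindex M G T.2) (uphalf p) p./2 T.1 i &
      i 0 <= P.1 <= i (p./2)%:Z]
  | Tup => [set P | P.1 = T.1 /\ exists2 i,
      consecutive_entries (Yindex N G T.1) (uphalf q) q./2 T.2 i &
      i 0 <= P.2 <= i (q./2)%:Z]
  | Tdown => [set P | P.1 = T.1 /\ exists2 i,
      consecutive_entries (Yindex N G T.1) q./2 (uphalf q) T.2 i &
      i (- (q./2)%:Z) <= P.2 <= i 0]
  end.

Definition ext_f (p q M N : nat) G T (tau : Ttype) : set (R * R) :=
  match tau with
  | Tleft => [set P | P.2 = T.2 /\ exists2 i,
      consecutive_entries (Xindex M G T.2) p./2 (uphalf p) T.1 i &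
      i 0 < P.1 <= i (uphalf p)%:Z]
  | Tright => [set P | P.2 = T.2 /\ exists2 i,
      consecutive_entries (Xindex M G T.2) (uphalf p) p./2 T.1 i &
      i (- (uphalf p)%:Z) <= P.1 < i 0]
  | Tup => [set P | P.1 = T.1 /\ exists2 i,
      consecutive_entries (Yindex N G T.1) (uphalf q) q./2 T.2 i &
      i (- (uphalf q)%:Z) <= P.2 < i 0]
  | Tdown => [set P | P.1 = T.1 /\ exists2 i,
      consecutive_entries (Yindex N G T.1) q./2 (uphalf q) T.2 i &
      i 0 < P.2 <= i (uphalf q)%:Z]
  end.

Definition ext (p q M N : nat) G T (tau : Ttype) : set (R * R) :=
  ext_e p q M N G T tau `|` ext_f p q M N G T tau.

Definition analysis_suitable (p q M N : nat) G : Prop :=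
  forall (T1 T2 : R * R) (tau1 tau2 : Ttype),
    Tjunction p q M N G T1 tau1 -> horizontal tau1 ->
    Tjunction p q M N G T2 tau2 -> ~~ horizontal tau2 ->
    ext p q M N G T1 tau1 `&` ext p q M N G T2 tau2 = set0.

End TJunctions.

(* Main.v *)
Require Import Defs.
From mathcomp Require Import all_boot all_order all_algebra.
From mathcomp Require Import all_classical all_reals all_analysis.
From mathcomp Require Import zify ring lra.

(* Elements of level k are cells of the dyadic grid of level k, so an admissible
   mesh is the set of leaves of a forest of bisected dyadic cells.  For a cell C
   of level k let B(C) be the box reaching as far beyond the sides of C as the
   patch of C does, i.e. half the degree (rounded down in the direction in which
   C is bisected, up in the other one) times the size of C.  Induction over the
   bisections shows that, as soon as C is bisected, all elements meeting the
   interior of B(C) have level at least k: as B(C) lies in the box of the parent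
   of C, only elements of level k - 1 have to be excluded, and the midpoints of
   those are close enough to that of C for them to belong to the patch of C.
   Hence all the grid lines of level k within B(C) belong to the skeleton.

   A T-junction T1 is an endpoint of the segment bisecting some cell C1, and its
   extension stays inside B(C1).  Let T2 be a T-junction of the other type, with
   cell C2, and let C1 have the higher level (the levels have distinct parities).
   If the extensions meet, then the line carrying the extension of T2 is a grid
   line of B(C1) and the extension of T2 reaches the midline of C1.  If T2 lies in
   the interior of B(C1), the grid line gives it a fourth edge; if it lies further
   away, then there are too many grid lines between T2 and the midline of C1. *)

Set Implicit Arguments.
Unset Strict Implicit.
Unset Printing Implicit Defensive.

Import Order.TTheory GRing.Theory Num.Theory.

Local Open Scope classical_set_scope.
Local Open Scope ring_scope.

(** * Directions, coordinates and half-open intervals *)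

Section Coordinates.
Context {R : realType}.
Implicit Types (d s : bool) (K L : rect R) (P : R * R).

Definition crd d P : R := if d then P.1 else P.2.
Definition pt d (u v : R) : R * R := if d then (u, v) else (v, u).
Definition lo d K : R := if d then xl K else yl K.
Definition hi d K : R := if d then xr K else yr K.

Lemma crd_pt d u v : crd d (pt d u v) = u. Proof. by case: d. Qed.
Lemma crdN_pt d u v : crd (~~ d) (pt d u v) = v. Proof. by case: d. Qed.
Lemma pt_crd d P : pt d (crd d P) (crd (~~ d) P) = P.
Proof. by case: d; case: P. Qed.

Lemma rect_eq K L :
  (forall d, lo d K = lo d L) -> (forall d, hi d K = hi d L) -> K = L.
Proof.
case: K => a b c e; case: L => a' b' c' e' hlo hhi.
by move: (hlo true) (hlo false) (hhi true) (hhi false) => /= -> -> -> ->.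
Qed.

(** Besides [x], the interval contains the points next to it in the positive direction if [s] is
    true, in the negative one otherwise. One choice per direction selects a quadrant at a point. *)
Definition halfin s (a b x : R) : bool :=
  if s then a <= x < b else a < x <= b.

Lemma halfin_closed s a b x : halfin s a b x -> a <= x <= b.
Proof. by case: s => /=; lra. Qed.

Definition overlap K L : Prop :=
  forall d, lo d K < hi d L /\ lo d L < hi d K.

Definition inside K L : Prop :=
  forall d, lo d L <= lo d K /\ hi d K <= hi d L.

End Coordinates.

(** * Dyadic grid points and levels *)

Section Dyadic.
Context {R : realType}.
Implicit Types (d : bool) (n k : nat) (m a b : int) (c : bool -> int).

Definition gp n m : R := m%:~R / 2 ^+ n.

Lemma gp_le n a b : (gp n a <= gp n b) = (a <= b).
Proof. by rewrite ler_pM2r ?ler_int // invr_gt0 exprn_gt0. Qed.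

Lemma gp_lt n a b : (gp n a < gp n b) = (a < b).
Proof. by rewrite ltr_pM2r ?ltr_int // invr_gt0 exprn_gt0. Qed.

Lemma gp_inj n : injective (gp n).
Proof. by move=> a b e; apply/le_anti; rewrite -!(gp_le n) e lexx. Qed.

Lemma gp_shift n j m : gp n m = gp (n + j) (m * 2 ^+ j).
Proof.
rewrite /gp exprD intrM rmorphXn /= invfM mulrCA !mulrA -mulrA.
by rewrite mulfV ?mulr1 1?mulrC // expf_neq0.
Qed.

Lemma gpS n m : gp n m = gp n.+1 (2 * m).
Proof. by rewrite (gp_shift n 1) addn1 expr1 mulrC. Qed.

Lemma gp0 m : gp 0 m = m%:~R.
Proof. by rewrite /gp expr0 divr1. Qed.

Lemma gp_refine n n' m : (n <= n')%N -> exists m', gp n m = gp n' m'.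
Proof.
by move=> /subnKC <-; exists (m * 2 ^+ (n' - n)); rewrite (gp_shift n (n' - n)).
Qed.

Lemma gp_nocross n n' m a : (n <= n')%N ->
  gp n' (a + 1) <= gp n m \/ gp n m <= gp n' a.
Proof.
move=> /gp_refine -/(_ m) [m' ->]; rewrite !gp_le.
by case: (lerP m' a) => h; [right | left; lia].
Qed.

Lemma gp_ancestor n n' a : (n <= n')%N ->
  exists b, gp n b <= gp n' a /\ gp n' (a + 1) <= gp n (b + 1).
Proof.
elim: n' a => [|n' IH] a.
  by rewrite leqn0 => /eqP ->; exists a.
rewrite leq_eqVlt => /predU1P[-> | /IH h]; first by exists a.
have [b [h1 h2]] := h (a %/ 2)%Z.
exists b; split; [apply: le_trans h1 _ | apply: le_trans h2].
  by rewrite gpS gp_le; lia.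
by rewrite [leRHS]gpS gp_le; lia.
Qed.

(** Cancelling factors 2 ends with denominator 1 or an odd numerator. In the second case the point
    is the midpoint of a grid interval, which identifies the bisection creating the line through
    it. *)
Lemma gp_lowest n m :
  (exists m', gp n m = gp 0 m') \/
  (exists n' m', (n' < n)%N /\ gp n m = gp n'.+1 (2 * m' + 1)).
Proof.
elim: n m => [|n IH] m; first by left; exists m.
have [[j ->]|[j ->]] : (exists j, m = 2 * j) \/ (exists j, m = 2 * j + 1).
- by case: (boolP (2 %| m)%Z) => h; [left|right]; exists (m %/ 2)%Z; lia.
- rewrite -gpS; case: (IH j) => [|[n' [m' [h e]]]]; first by left.
  by right; exists n', m'; split=> //; apply: ltnW.
- by right; exists n, j.
Qed.

(* The exponent of the size in direction [d] of the elements of level [k]; an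
   element of level [k] is bisected in direction [sd k], where [true] is the
   [x]-direction. *)
Definition ex d k : nat := (k + d)./2.
Definition sd k : bool := ~~ odd k.

Lemma exS d k : ex d k.+1 = (ex d k + (d == sd k))%N.
Proof. by rewrite /ex /sd; case: d; case: (boolP (odd k)) => /=; lia. Qed.

Lemma ex_le d k k' : (k <= k')%N -> (ex d k <= ex d k')%N.
Proof. by rewrite /ex => h; lia. Qed.

Lemma ex_split d n k' : (n < ex d k')%N ->
  exists k, [/\ (k < k')%N, ex d k = n & sd k = d].
Proof.
rewrite /ex /sd; case: d => h; [exists n.*2|exists n.*2.+1]; split; lia.
Qed.

(** * Cells of the dyadic grid and their bisection *)

Definition cell k c : rect R :=
  Rect (gp (ex true k) (c true)) (gp (ex true k) (c true + 1))
       (gp (ex false k) (c false)) (gp (ex false k) (c false + 1)).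

Lemma lo_cell d k c : lo d (cell k c) = gp (ex d k) (c d).
Proof. by case: d. Qed.

Lemma hi_cell d k c : hi d (cell k c) = gp (ex d k) (c d + 1).
Proof. by case: d. Qed.

Lemma lo_hi_cell d k c : lo d (cell k c) < hi d (cell k c).
Proof. by rewrite lo_cell hi_cell gp_lt; lia. Qed.

Lemma cell_nocross d n m k c : (n <= ex d k)%N ->
  hi d (cell k c) <= gp n m \/ gp n m <= lo d (cell k c).
Proof. by move=> h; rewrite hi_cell lo_cell; apply: gp_nocross. Qed.

Lemma cell_nested k c k' c' : (k <= k')%N ->
  overlap (cell k' c') (cell k c) -> inside (cell k' c') (cell k c).
Proof.
move=> /ex_le hk ho d; have [] := ho d; move: (hk d) => {}hk.
have := cell_nocross (c d) c' hk; have := cell_nocross (c d + 1) c' hk.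
by have := lo_hi_cell d k' c'; rewrite (hi_cell d k) (lo_cell d k); lra.
Qed.

Lemma cell_overlap_eq k c c' :
  overlap (cell k c) (cell k c') -> cell k c = cell k c'.
Proof.
move=> ho; have h1 := cell_nested (leqnn k) ho.
have h2 : inside (cell k c') (cell k c).
  by apply: cell_nested => // d; have [] := ho d.
by apply: rect_eq => d; have [] := h1 d; have [] := h2 d; lra.
Qed.

Lemma cell_ancestor k k' c' : (k <= k')%N ->
  exists c, inside (cell k' c') (cell k c).
Proof.
move=> /ex_le hk.
have [b [hb1 hb2]] := gp_ancestor (c' true) (hk true).
have [b' [hb1' hb2']] := gp_ancestor (c' false) (hk false).
by exists (fun d => if d then b else b'); case.
Qed.

Lemma inside_overlap K (C : rect R) :
  (forall d, lo d K < hi d K) -> inside K C -> overlap K C.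
Proof. by move=> hK hi d; have [] := hi d; have := hK d; lra. Qed.

Lemma level_cell k c : level (cell k c) = k%:R.
Proof.
rewrite /level; have -> : area (cell k c) = (2 ^+ k)^-1.
  have gp_succ n a : gp n (a + 1) - gp n a = (2 ^+ n)^-1.
    by rewrite /gp intrD mulrDl mul1r addrC addKr.
  by rewrite /area /= !gp_succ -invfM -exprD; congr (_ ^+ _)^-1; rewrite /ex; lia.
have ln2 : ln (2 : R) != 0 by rewrite gt_eqF // ln_gt0 // ltr1n.
rewrite lnV ?posrE ?exprn_gt0 // lnXn // -[_ *+ k]mulr_natl.
by rewrite mulNr opprK mulfK.
Qed.

Lemma level_inj k c k' c' : cell k c = cell k' c' -> k = k'.
Proof. by move/(congr1 level); rewrite !level_cell => /eqP; rewrite eqr_nat => /eqP. Qed.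

Lemma even_level_nat k : even_level (k%:R : R) = sd k.
Proof.
rewrite /even_level /sd; apply/idP/idP.
  move=> /intrP[z hz]; have : (k%:Z%:~R = (2 * z)%:~R :> R).
    by rewrite intrM -hz mulrC divfK.
  by move=> /eqP; rewrite eqr_int => /eqP h; lia.
move=> h; apply/intrP; exists (k./2)%:Z.
have e : k = (2 * k./2)%N by lia.
by rewrite {1}e natrM mulrC mulKf.
Qed.

Definition subindex k c (b : bool) : bool -> int :=
  fun d => if d == sd k then 2 * c d + b%:Z else c d.

Lemma lo_child d k c (b : bool) : lo d (cell k.+1 (subindex k c b)) =
  if (d == sd k) && b then gp (ex d k).+1 (2 * c d + 1) else lo d (cell k c).
Proof.
rewrite !lo_cell exS /subindex; case: eqP => _ /=; last by rewrite addn0.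
by rewrite addn1; case: b => //; rewrite addr0 -gpS.
Qed.

Lemma hi_child d k c (b : bool) : hi d (cell k.+1 (subindex k c b)) =
  if (d == sd k) && ~~ b then gp (ex d k).+1 (2 * c d + 1) else hi d (cell k c).
Proof.
rewrite !hi_cell exS /subindex; case: eqP => _ /=; last by rewrite addn0.
rewrite addn1; case: b => //=; last by rewrite addr0.
by rewrite [RHS]gpS; congr (gp _ _); lia.
Qed.

Lemma gp_half n a : (gp n a + gp n (a + 1)) / 2 = gp n.+1 (2 * a + 1).
Proof.
rewrite [gp n a]gpS [gp n (a+1)]gpS /gp -mulrDl -intrD.
have -> : 2 * a + 2 * (a + 1) = (2 * a + 1) * 2 by ring.
by rewrite intrM mulrAC mulfK.
Qed.

Lemma childE k c : child (cell k c) =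
  [set cell k.+1 (subindex k c false); cell k.+1 (subindex k c true)].
Proof.
rewrite /child level_cell even_level_nat /= !gp_half.
by case: ifP => h; congr [set _; _]; apply: rect_eq; case;
  rewrite ?lo_child ?hi_child ?h.
Qed.

Lemma child_inside k c (b : bool) : inside (cell k.+1 (subindex k c b)) (cell k c).
Proof.
move=> d; rewrite lo_child hi_child lo_cell hi_cell; split; case: ifP => // _.
  by rewrite gpS gp_le; lia.
by rewrite [leRHS]gpS gp_le; lia.
Qed.

End Dyadic.

(** * Edges and skeleton of a finite mesh *)

Section SkeletonTheory.
Context {R : realType}.
Implicit Types (d s : bool) (G : mesh R) (K L : rect R) (P T : R * R).

Definition edge d G A B : Prop := if d then hedge G A B else vedge G A B.

Definition Sk d G : set (R * R) := if d then hSk G else vSk G.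

Definition edge_toward d s G T : Prop :=
  if s then exists B, edge d G T B else exists A, edge d G A T.

Definition on_side d K (v : R) : Prop := v = lo d K \/ v = hi d K.

Lemma nodeE G P : node G P <->
  exists2 K, G K & forall d, on_side d K (crd d P).
Proof.
split=> -[K GK].
  by case=> h1 h2; exists K => //; case.
by move=> h; exists K => //; split; [apply: (h true)|apply: (h false)].
Qed.

Lemma edgeE d G A B : edge d G A B <->
  [/\ node G A, node G B, crd (~~ d) A = crd (~~ d) B, crd d A < crd d B &
    (exists2 K, G K & [/\ lo d K <= crd d A, crd d B <= hi d K &
                          on_side (~~ d) K (crd (~~ d) A)]) /\
    (forall P, node G P -> crd (~~ d) P = crd (~~ d) A ->
       ~ (crd d A < crd d P < crd d B))].
Proof. by case: d. Qed.

Lemma seq_min (r : seq R) (Q : R -> Prop) :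
  (exists2 z, z \in r & Q z) ->
  exists z, [/\ z \in r, Q z & forall y, y \in r -> Q y -> z <= y].
Proof.
elim: r => [[z]//|x r IH] [z].
have [[y hy Qy] _|hn] := pselect (exists2 y, y \in r & Q y); last first.
  rewrite inE => /predU1P[->|zr] Qz; last by case: hn; exists z.
  exists x; split; rewrite ?mem_head // => y.
  by rewrite inE => /predU1P[->//|yr] Qy; case: hn; exists y.
have [m [mr Qm hm]] :
    exists z, [/\ z \in r, Q z & forall y, y \in r -> Q y -> z <= y].
  by apply: IH; exists y.
have [[Qx hx] _|hx _] := pselect (Q x /\ x <= m).
  exists x; split; rewrite ?mem_head // => t; rewrite inE => /predU1P[->//|tr].
  by move=> /(hm _ tr); apply: le_trans.
exists m; split=> //; first by rewrite inE mr orbT.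
move=> t; rewrite inE => /predU1P[->|/hm//] Qx.
by case: (leP m x) => // h; case: hx; split=> //; apply: ltW.
Qed.

Lemma seq_max (r : seq R) (Q : R -> Prop) :
  (exists2 z, z \in r & Q z) ->
  exists z, [/\ z \in r, Q z & forall y, y \in r -> Q y -> y <= z].
Proof.
move=> [z zr Qz].
have [|m [/mapP[x xr ->] Qm hm]] := @seq_min (map -%R r) (fun y => Q (- y)).
  by exists (- z); rewrite ?opprK // map_f.
exists x; split=> //; first by rewrite opprK in Qm.
by move=> y yr Qy; rewrite -lerN2; apply: hm; rewrite ?map_f ?opprK.
Qed.

Lemma on_side_pt d d' K z v : on_side d K z -> on_side (~~ d) K v ->
  on_side d' K (crd d' (pt d z v)).
Proof. by case: d; case: d'. Qed.

(** There are finitely many nodes on the line, among them the ends of the side of [K]. The last one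
    before [x] and the first one after it are consecutive and bound a segment of that side. *)
Lemma edge_around d s G K v x : finite_set G -> G K -> on_side (~~ d) K v ->
  halfin s (lo d K) (hi d K) x ->
  exists a b, edge d G (pt d a v) (pt d b v) /\ halfin s a b x.
Proof.
move=> /finite_seqP[r Gr] GK hv hx.
pose c := map (lo d) r ++ map (hi d) r.
pose Q z := node G (pt d z v).
have memc z : Q z -> z \in c.
  move=> /nodeE[L GL /(_ d)]; rewrite crd_pt mem_cat.
  by move: GL; rewrite Gr /= => Lr [] ->; rewrite map_f ?orbT.
have Qside z : on_side d K z -> Q z.
  move=> hz; apply/nodeE; exists K => // d'.
  exact: on_side_pt.
pose before z := if s then z <= x else z < x.
have [|a [_ [Qa ha] amax]] := @seq_max c (fun z => Q z /\ before z).
  exists (lo d K); first by apply/memc/Qside; left.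
  by split; [apply: Qside; left | move: hx; rewrite /before; case: (s); case/andP].
have [|b [_ [Qb hb] bmin]] := @seq_min c (fun z => Q z /\ ~~ before z).
  exists (hi d K); first by apply/memc/Qside; right.
  split; [by apply: Qside; right | move: hx; rewrite /before -/before].
  by case: (s) => /andP[_]; rewrite -?ltNge -?leNgt.
have hab : halfin s a b x.
  move: ha hb; rewrite /halfin /before; case: (s) => -> /=;
  by rewrite -?ltNge -?leNgt.
have ltab : a < b.
  by move: hab; rewrite /halfin; case: (s) => /=; lra.
exists a, b; split=> //; apply/edgeE; rewrite !crd_pt !crdN_pt.
have lea : lo d K <= a.
  apply: amax; first by apply/memc/Qside; left.
  by split; [apply: Qside; left | move: hx; rewrite /before; case: (s); case/andP].
have leb : b <= hi d K.
  apply: bmin; first by apply/memc/Qside; right.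
  split; [by apply: Qside; right | move: hx; rewrite /before].
  by case: (s) => /andP[_]; rewrite -?ltNge -?leNgt.
split=> //; split; first by exists K.
move=> P nP hP; rewrite -(pt_crd d P) hP in nP.
have Pc := memc _ nP.
case: (boolP (before (crd d P))) => hbP.
  by have := amax _ Pc (conj nP hbP); lra.
by have := bmin _ Pc (conj nP hbP); lra.
Qed.

(** An edge has no node in its interior, so the edge around the node [P] ends at [P]; the half-open
    interval fixes at which end. *)
Lemma edge_toward_side d s G K P : finite_set G -> node G P -> G K ->
  on_side (~~ d) K (crd (~~ d) P) -> halfin s (lo d K) (hi d K) (crd d P) ->
  edge_toward d s G P.
Proof.
move=> fG nP GK hv /(edge_around fG GK hv)[a [b [e hab]]].
have /edgeE[_ _ _ _ [_ hn]] := e.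
have := hn P nP; rewrite !crd_pt crdN_pt => /(_ erefl) hn'.
rewrite /edge_toward; case: s hab => /= hab.
  exists (pt d b (crd (~~ d) P)).
  by have {1}<- : pt d a (crd (~~ d) P) = P by rewrite -[RHS](pt_crd d); congr pt; lra.
exists (pt d a (crd (~~ d) P)).
by have {2}<- : pt d b (crd (~~ d) P) = P by rewrite -[RHS](pt_crd d); congr pt; lra.
Qed.

Lemma Sk_side d G K P : finite_set G -> G K -> on_side (~~ d) K (crd (~~ d) P) ->
  lo d K < hi d K -> lo d K <= crd d P <= hi d K -> Sk d G P.
Proof.
move=> fG GK hv hK hP.
have [s hs] : exists s, halfin s (lo d K) (hi d K) (crd d P).
  by case: (ltP (crd d P) (hi d K)) => h; [exists true|exists false] => /=; lra.
have [a [b [e /halfin_closed hab]]] := edge_around fG GK hv hs.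
have : exists A B, [/\ edge d G A B, crd (~~ d) P = crd (~~ d) A &
    crd d A <= crd d P <= crd d B].
  by exists (pt d a (crd (~~ d) P)), (pt d b (crd (~~ d) P)); rewrite !crd_pt crdN_pt.
by case: (d).
Qed.

Lemma edge_toward_element d s G T : edge_toward d s G T ->
  exists K, [/\ G K, on_side (~~ d) K (crd (~~ d) T) &
                lo d K <= crd d T <= hi d K].
Proof.
rewrite /edge_toward; case: s => -[B] /edgeE[_ _ e lt [[K GK [h1 h2 h3]] _]];
  exists K; split=> //; rewrite -?e //; lra.
Qed.

Lemma valence_three G T : (edges_at G T #= `I_3)%card ->
  ~ (forall d s, edge_toward d s G T).
Proof.
move=> h3 h.
have [B1 e1] := h true true; have [A1 e2] := h true false.
have [B2 e3] := h false true; have [A2 e4] := h false false.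
have /edgeE /= [_ _ _ l1 _] := e1; have /edgeE /= [_ _ _ l2 _] := e2.
have /edgeE /= [_ _ E3 l3 _] := e3; have /edgeE /= [_ _ E4 l4 _] := e4.
have : (edges_at G T #<= `I_3)%card by rewrite (card_le_eql h3).
case/pcard_leP => f.
have fI e : edges_at G T e -> (f e < 3)%N by move=> /(@funS _ _ _ _ f).
have fi e e' : edges_at G T e -> edges_at G T e' -> f e = f e' -> e = e'.
  by move=> he he'; apply: (@inj _ _ _ f); rewrite inE.
have h1 : edges_at G T (T, B1) by split; [left|left].
have h2 : edges_at G T (A1, T) by split; [left|right].
have h3' : edges_at G T (T, B2) by split; [right|left].
have h4 : edges_at G T (A2, T) by split; [right|right].
have n12 : f (T, B1) <> f (A1, T)
  by move/(fi _ _ h1 h2) => [e _]; rewrite -e ltxx in l2.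
have n34 : f (T, B2) <> f (A2, T)
  by move/(fi _ _ h3' h4) => [e _]; rewrite -e ltxx in l4.
have n13 : f (T, B1) <> f (T, B2)
  by move/(fi _ _ h1 h3') => [e]; move: l1; rewrite e E3 ltxx.
have n24 : f (A1, T) <> f (A2, T)
  by move/(fi _ _ h2 h4) => [e]; move: l2; rewrite e E4 ltxx.
have n14 : f (T, B1) <> f (A2, T)
  by move/(fi _ _ h1 h4) => [e _]; rewrite -e ltxx in l4.
have n23 : f (A1, T) <> f (T, B2)
  by move/(fi _ _ h2 h3') => [e _]; rewrite e ltxx in l2.
have := fI _ h1; have := fI _ h2; have := fI _ h3'; have := fI _ h4; lia.
Qed.

End SkeletonTheory.

(** * Consecutive entries of sets containing grid points *)

Section ConsecutiveEntries.
Context {R : realType}.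
Implicit Types (S : set R) (l r n : nat) (t D : R) (i : int -> R) (m : int).

(** Consecutive entries skip no point of [S]: an entry below a grid point of [S] is followed by one
    that is not beyond it. A grid point beyond [D] bounds the entries anyway. *)
Lemma consecutive_le_grid S l r t i n m D :
  consecutive_entries S l r t i -> (forall z, S z -> z <= D) ->
  t < gp n m ->
  (forall j : nat, (j < r)%N -> gp n (m + j%:Z) <= D -> S (gp n (m + j%:Z))) ->
  forall j : nat, (j < r)%N -> i j.+1%:Z <= gp n (m + j%:Z).
Proof.
move=> [i0 Si nxt] SD ht hS.
have step (j : nat) : (j < r)%N -> i j%:Z < gp n (m + j%:Z) ->
    i j.+1%:Z <= gp n (m + j%:Z).
  move=> hj lt_j; have [|_] := nxt j%:Z; first lia.
  rewrite -PoszD addn1 => no; have [/(hS _ hj)/no hno|gtD] := leP (gp n (m + j%:Z)) D.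
    by rewrite leNgt; apply/negP => gt_j; apply: hno; apply/andP.
  by apply: le_trans (ltW gtD); apply/SD/Si; lia.
elim=> [|j IH] hj; apply: step => //; first by rewrite i0 addr0.
by apply: le_lt_trans (IH (ltnW hj)) _; rewrite gp_lt; lia.
Qed.

Lemma consecutive_ge_grid S l r t i n m :
  consecutive_entries S l r t i -> (forall z, S z -> 0 <= z) ->
  gp n m < t ->
  (forall j : nat, (j < l)%N -> 0 <= gp n (m - j%:Z) :> R ->
     S (gp n (m - j%:Z))) ->
  forall j : nat, (j < l)%N -> gp n (m - j%:Z) <= i (- j.+1%:Z).
Proof.
move=> [i0 Si nxt] SD ht hS.
have step (j : nat) : (j < l)%N -> gp n (m - j%:Z) < i (- j%:Z) ->
    gp n (m - j%:Z) <= i (- j.+1%:Z).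
  move=> hj lt_j; have [|_] := nxt (- j.+1%:Z); first lia.
  have -> : - j.+1%:Z + 1 = - j%:Z by lia.
  move=> no; have [/(hS _ hj)/no hno|gtD] := leP 0 (gp n (m - j%:Z) : R).
    by rewrite leNgt; apply/negP => gt_j; apply: hno; apply/andP.
  by apply: le_trans (ltW gtD) _; apply/SD/Si; lia.
elim=> [|j IH] hj; apply: step => //; first by rewrite oppr0 i0 subr0.
by apply: lt_le_trans (IH (ltnW hj)); rewrite gp_lt; lia.
Qed.

Lemma consecutive_ge S l r t i : consecutive_entries S l r t i -> t <= i r%:Z.
Proof.
move=> [<- _ nxt]; suff h : forall j : nat, (j <= r)%N -> i 0 <= i j%:Z by exact: h.
elim=> [//|j IH] hj; apply: le_trans (IH (ltnW hj)) _.
by have [|/ltW] := nxt j%:Z; [lia | rewrite -PoszD addn1].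
Qed.

Lemma consecutive_le S l r t i :
  consecutive_entries S l r t i -> i (- l%:Z) <= t.
Proof.
move=> [<- _ nxt].
suff h : forall j : nat, (j <= l)%N -> i (- j%:Z) <= i 0 by exact: h.
elim=> [|j IH] hj; first by rewrite oppr0.
apply: le_trans (IH (ltnW hj)).
have [|/ltW] := nxt (- j.+1%:Z); first lia.
by have -> : - j.+1%:Z + 1 = - j%:Z by lia.
Qed.

End ConsecutiveEntries.

(** * The grading of admissible meshes *)

Section Invariant.
Context {R : realType}.
Context (p q M N : nat).
Implicit Types (d : bool) (G : mesh R) (K L : rect R) (c : bool -> int).
Implicit Types (s : bool -> bool) (P : R * R).

Definition deg d : nat := if d then p else q.

(* The patch of an element of level [k] reaches [reach d k] times the size of
   the element beyond each of its sides in direction [d]. *)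
Definition reach d k : nat :=
  if d == sd k then (deg d)./2 else uphalf (deg d).

(** For C = [cell k c]: [L] meets the interior of the box B(C). *)
Definition region_overlap L k c : Prop := forall d,
  lo d L < gp (ex d k) (c d + 1 + (reach d k)%:Z) /\
  gp (ex d k) (c d - (reach d k)%:Z) < hi d L.

Definition width d : R := if d then M%:R else N%:R.

(** The cover is stated by quadrants: even at a node, each quadrant pointing into the domain has its
    element. In the last field a finer element inside C shows that C has been bisected; then no
    element meeting the interior of B(C) is coarser than C. *)
Record graded_partition G : Prop := GradedPartition {
  partition_finite : finite_set G;
  partition_cell : forall L, G L -> exists k c, L = cell k c;
  partition_disjoint : forall K L, G K -> G L -> overlap K L -> K = L;
  partition_domain : forall L, G L ->
    forall d, 0 <= lo d L /\ hi d L <= width d;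
  partition_cover : forall s P,
    (forall d, halfin (s d) 0 (width d) (crd d P)) ->
    exists2 L, G L & forall d, halfin (s d) (lo d L) (hi d L) (crd d P);
  partition_graded : forall k c k1 c1 k2 c2,
    G (cell k1 c1) -> (k < k1)%N -> inside (cell k1 c1 : rect R) (cell k c) ->
    G (cell k2 c2) -> region_overlap (cell k2 c2) k c -> (k <= k2)%N }.

Lemma halfin_unit b n (x : R) : halfin b 0 n%:R x ->
  exists2 m, (1 <= m <= n)%N & halfin b (m%:R - 1) m%:R x.
Proof.
elim: n => [|n IH]; first by case: b => /=; lra.
move=> hx; have [/IH[m hm h]|h] := boolP (halfin b 0 n%:R x).
  by exists m => //; lia.
exists n.+1; first lia.
by move: hx h; case: b {IH} => /=; rewrite -natr1; lra.
Qed.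

Definition unit_index (m n : nat) : bool -> int :=
  fun d => if d then m%:Z - 1 else n%:Z - 1.

Lemma unit_cell m n :
  cell 0 (unit_index m n) = Rect (m%:R - 1) m%:R (n%:R - 1) n%:R :> rect R.
Proof. by rewrite /cell /unit_index /= !gp0 !subrK !intrB. Qed.

Lemma graded_init : graded_partition (init_mesh M N).
Proof.
have level0 k c : init_mesh M N (cell k c : rect R) -> k = 0%N.
  by case=> m [n [_ _]]; rewrite -unit_cell => /level_inj.
split.
- apply: (@sub_finite_set _ _ ((fun mn : nat * nat => cell 0 (unit_index mn.1 mn.2))
      @` (`I_M.+1 `*` `I_N.+1))); last first.
    by apply: finite_image; apply: finite_setX; apply: finite_II.
  move=> K [m [n [hm hn ->]]]; exists (m, n); last by rewrite unit_cell.
  by split=> /=; lia.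
- by move=> L [m [n [_ _ ->]]]; exists 0%N, (unit_index m n); rewrite unit_cell.
- move=> K L [m [n [_ _ ->]]] [m' [n' [_ _ ->]]].
  by rewrite -!unit_cell; apply: cell_overlap_eq.
- move=> L [m [n [/andP[hm1 hm2] /andP[hn1 hn2] ->]]] d.
  by rewrite /lo /hi /width; case: d => /=; rewrite subr_ge0 ler1n ler_nat.
- move=> s P h; have [m hm hx] := halfin_unit (h true).
  have [n hn hy] := halfin_unit (h false).
  exists (Rect (m%:R - 1) m%:R (n%:R - 1) n%:R); first by exists m, n.
  by case.
- by move=> k c k1 c1 k2 c2 /level0 ->.
Qed.

Lemma bisectE G k c L : bisect G (cell k c) L <->
  (G L /\ L <> cell k c) \/ exists b : bool, L = cell k.+1 (subindex k c b).
Proof.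
rewrite /bisect childE; split.
  case=> [[GL nL]|[->|->]]; [by left|right; by exists false|right; by exists true].
case=> [[GL nL]|[[] ->]]; [by left|right; by right|right; by left].
Qed.

Context (hp : (2 <= p)%N) (hq : (2 <= q)%N).

Lemma deg_ge2 d : (2 <= deg d)%N. Proof. by case: d. Qed.

Lemma sdS k : sd k.+1 = ~~ sd k. Proof. by []. Qed.

(** From parent to child, the size in the bisected direction halves while the reach goes from half
    the degree rounded down to rounded up, at most a doubling as the degree is at least 2. In the
    other direction the size stays and the reach does not grow. *)
Lemma region_parent L k c c' : inside (cell k.+1 c : rect R) (cell k c') ->
  region_overlap L k.+1 c -> region_overlap L k c'.
Proof.
move=> hi_ ho d; have := hi_ d; have := ho d; rewrite !lo_cell !hi_cell.
rewrite /reach exS sdS; have := deg_ge2 d.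
case: (eqVneq d (sd k)) => [->|hd] h2; last first.
  have -> : d == ~~ sd k by case: d {h2 ho hi_} hd; case: (sd k).
  rewrite addn0 !gp_le => -[h3 h4] [h5 h6].
  have -> : c' d = c d by lia.
  split; [apply: lt_le_trans h3 _ | apply: le_lt_trans h4]; rewrite gp_le; lia.
have -> : (sd k == ~~ sd k) = false by case: (sd k).
rewrite addn1 ![gp (ex (sd k) k) _]gpS !gp_le => -[h3 h4] [h5 h6].
split; [apply: lt_le_trans h3 _ | apply: le_lt_trans h4]; rewrite gp_le; lia.
Qed.

Lemma crd_Dpq d k :
  crd d (Dpq p q (k%:R : R)) = gp (ex d k).+1 (2 * (reach d k)%:Z + 1).
Proof.
have pow2 (n : nat) : 2 `^ (- n%:R) = (2 ^+ n)^-1 :> R.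
  by rewrite powRN powR_mulrn.
have gpE (n m : nat) :
    gp n.+1 (2 * m%:Z + 1) = (2 ^+ n)^-1 * (m%:R + 2^-1) :> R.
  rewrite /gp intrD intrM exprS invfM -pmulrn; set x := (_ ^+ _)^-1; lra.
rewrite /Dpq even_level_nat gpE /reach /ex; case: ifP => hk.
  have -> : (k%:R / 2 : R) = (k./2)%:R.
    have e : k = (2 * k./2)%N by move: hk; rewrite /sd; lia.
    by rewrite {1}e natrM mulrC mulKf.
  rewrite pow2; case: d => /=; rewrite ?addn0 //.
  by congr ((2 ^+ _)^-1 * _); move: hk; rewrite /sd; lia.
have -> : ((k%:R + 1) / 2 : R) = ((k + 1)./2)%:R.
  have e : (k + 1 = 2 * (k + 1)./2)%N by move: hk; rewrite /sd; lia.
  by rewrite natr1 -addn1 {1}e natrM mulrC mulKf.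
rewrite pow2; case: d => //=; rewrite addn0.
have -> : (k + 1)./2 = k./2.+1 by move: hk; rewrite /sd; lia.
rewrite exprS invfM; set x := (_ ^+ _)^-1; lra.
Qed.

Lemma crd_Dist_cell d k1 c1 k2 c2 : crd d (Dist (cell k1 c1) (cell k2 c2)) =
  `|gp (ex d k1).+1 (2 * c1 d + 1) - gp (ex d k2).+1 (2 * c2 d + 1)| :> R.
Proof. by rewrite -!gp_half; case: d. Qed.

Lemma gp_dist_le n (a b e : int) :
  `|a - b| <= e -> `|gp n a - gp n b| <= gp n e :> R.
Proof.
move=> h; rewrite /gp -mulrBl -intrB normrM normfV normrX normr_nat.
by rewrite ler_pM2r ?invr_gt0 ?exprn_gt0 // -intr_norm ler_int.
Qed.

(** All bounds are grid points of level [k.+1], so a strict overlap amounts to a whole grid step. In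
    the direction in which the element is twice as large, this just brings the midpoints within
    reach plus one half. *)
Lemma region_patch G k c c2 : G (cell k c2) ->
  region_overlap (cell k c2) k.+1 c -> Defs.patch p q G (cell k.+1 c) (cell k c2).
Proof.
move=> GL ho.
suff h d : crd d (Dist (cell k c2) (cell k.+1 c)) <=
    crd d (Dpq p q (level (cell k.+1 c : rect R))).
  by split=> //; [apply: (h true) | apply: (h false)].
rewrite level_cell crd_Dpq crd_Dist_cell.
have := ho d; rewrite lo_cell hi_cell exS; case: eqP => _; rewrite ?addn0 ?addn1.
  rewrite [gp (ex d k).+1 (2 * c2 d + 1)]gpS.
  rewrite [gp (ex d k) (c2 d)]gpS [gp (ex d k) (c2 d + 1)]gpS !gp_lt.
  by move=> [h1 h2]; apply: gp_dist_le; lia.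
by rewrite !gp_lt => -[h1 h2]; apply: gp_dist_le; lia.
Qed.

(** The cell itself shows that its parent has been bisected, so the grading around the parent leaves
    only the parent's level to be excluded; an element of that level would lie in the patch, against
    admissibility. *)
Lemma graded_patch G k c k2 c2 : graded_partition G ->
  admissible_bisection p q G (cell k c) ->
  G (cell k2 c2) -> region_overlap (cell k2 c2) k c -> (k <= k2)%N.
Proof.
move=> hG [GK adm] GL ho; case: k => [//|k] in GK adm ho *.
have [c' hc'] := cell_ancestor (R := R) c (leqnSn k).
have := partition_graded hG GK (ltnSn k) hc' GL (region_parent hc' ho).
rewrite leq_eqVlt => /predU1P[e|//]; rewrite -{}e in GL ho *.
by have := adm _ (region_patch GL ho); rewrite !level_cell ler_nat.
Qed.

Lemma region_overlap_sub K L k c :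
  inside K L -> region_overlap K k c -> region_overlap L k c.
Proof. by move=> h ho d; have [] := h d; have [] := ho d; lra. Qed.

Lemma cell_index k c c' : cell k c = cell k c' :> rect R -> forall d, c d = c' d.
Proof.
move=> e d; apply: (@gp_inj R (ex d k)).
by rewrite -!lo_cell e.
Qed.

Lemma graded_bisect G k c : graded_partition G ->
  admissible_bisection p q G (cell k c) ->
  graded_partition (bisect G (cell k c)).
Proof.
move=> hG adm; have [GK _] := adm.
have child_disjoint b L : G L -> overlap (cell k.+1 (subindex k c b)) L ->
    L = cell k c.
  move=> GL ho; apply: (partition_disjoint hG) => // d.
  by have [] := ho d; have [] := child_inside (R := R) k c b d; lra.
split.
- rewrite /bisect childE finite_setU; split.
    by apply: finite_setD; apply: partition_finite hG.
  by rewrite finite_setU; split; apply: finite_set1.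
- move=> L /bisectE[[/(partition_cell hG)]//|[b ->]].
  by exists k.+1, (subindex k c b).
- move=> K L /bisectE[[GK' nK]|[b ->]] /bisectE[[GL nL]|[b' ->]] ho.
  + exact: partition_disjoint hG _ _ GK' GL ho.
  + by case: nK; apply: (child_disjoint b') => // d; have [] := ho d.
  + by case: nL; apply: (child_disjoint b).
  + exact: cell_overlap_eq.
- move=> L /bisectE[[/(partition_domain hG)]//|[b ->]] d.
  by have [] := partition_domain hG GK d; have [] := child_inside (R := R) k c b d; lra.
- move=> s P /(partition_cover hG)[L GL hL].
  have [e|nL] := pselect (L = cell k c); last by exists L => //; apply/bisectE; left.
  have [b hb] : exists b : bool, halfin (s (sd k))
      (lo (sd k) (cell k.+1 (subindex k c b))) (hi (sd k) (cell k.+1 (subindex k c b)))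
      (crd (sd k) P).
    set z : R := gp (ex (sd k) k).+1 (2 * c (sd k) + 1).
    have := hL (sd k); rewrite e => hz.
    have [h|h] := boolP (halfin (s (sd k)) (lo (sd k) (cell k c)) z (crd (sd k) P)).
      by exists false; rewrite lo_child hi_child eqxx.
    exists true; rewrite lo_child hi_child eqxx /= -/z.
    by move: h hz; rewrite /halfin; case: (s _); lra.
  exists (cell k.+1 (subindex k c b)); first by apply/bisectE; right; exists b.
  move=> d; have [->//|hd] := eqVneq d (sd k).
  by rewrite lo_child hi_child (negPf hd) /= -e.
- move=> k0 c0 k1 c1 k2 c2 h1 lt01 in01 h2 ho.
  (* A child may be replaced by the bisected cell, which is larger and of lower level; so the second
     element can be taken in [G]. *)
  have [k2' [c2' [le2 {}h2 {}ho]]] : exists k2' c2', [/\ (k2' <= k2)%N,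
      G (cell k2' c2') & region_overlap (cell k2' c2') k0 c0].
    move/bisectE: h2 => [[GL _]|[b e]]; first by exists k2, c2.
    have e2 := level_inj e; exists k, c; split=> //; first by rewrite e2.
    by apply: region_overlap_sub ho; rewrite e; apply: child_inside.
  apply: leq_trans le2; move/bisectE: h1 => [[GL _]|[b e]].
    exact: (partition_graded hG GL lt01 in01 h2 ho).
  have e1 := level_inj e; rewrite {}e {}e1 ltnS in lt01 in01.
  have ov : overlap (cell k c : rect R) (cell k0 c0).
    move=> d; have := lo_hi_cell (R := R) d k.+1 (subindex k c b).
    by have [] := in01 d; have [] := child_inside (R := R) k c b d; lra.
  (* The first element is a child of the bisected cell. At equal levels this cell is C and
     admissibility applies; otherwise it is itself a finer element inside C. *)
  move: lt01; rewrite leq_eqVlt => /predU1P[e|lt0].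
    rewrite e in ov ho *.
    have ec := cell_index (cell_overlap_eq ov).
    apply: (graded_patch hG adm h2) => d; have := ho d.
    by rewrite -ec.
  exact: (partition_graded hG GK lt0 (cell_nested (ltnW lt0) ov) h2 ho).
Qed.

Lemma admissible_graded G : admissible p q M N G -> graded_partition G.
Proof.
elim=> [|{}G MM G' _ hG [_ [r [_ _ adm ->]]]]; first exact: graded_init.
elim: r G hG adm {MM G'} => //= K r IH G hG [admK admr].
apply: IH => //; have [GK _] := admK.
by have [k [c e]] := partition_cell hG GK; rewrite e in admK *; apply: graded_bisect.
Qed.

End Invariant.

(** * Grid lines around a bisected cell *)

Section Crossing.
Context {R : realType}.
Context (p q M N : nat) (G : mesh R).
Context (hp : (2 <= p)%N) (hq : (2 <= q)%N).
Context (hG : graded_partition p q M N G).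
Implicit Types (d e s : bool) (K L : rect R) (P T : R * R).
Implicit Types (k : nat) (c : bool -> int).

Local Notation deg := (deg p q).
Local Notation reach := (reach p q).
Local Notation width := (@width R M N).

Definition region_lo d k c : R := gp (ex d k) (c d - (reach d k)%:Z).
Definition region_hi d k c : R := gp (ex d k) (c d + 1 + (reach d k)%:Z).

Definition bisected k c : Prop := exists k1 c1,
  [/\ G (cell k1 c1), (k < k1)%N & inside (cell k1 c1 : rect R) (cell k c)].

Definition interior P : Prop := forall d, 0 < crd d P < width d.

Lemma bisected_domain k c d : bisected k c ->
  0 <= lo d (cell k c : rect R) /\ hi d (cell k c : rect R) <= width d.
Proof.
move=> [k1 [c1 [GL _ /(_ d)]]].
have := partition_domain hG GL d; have := lo_hi_cell (R := R) d k1 c1.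
have := cell_nocross (R := R) 0 c (leq0n (ex d k)).
have [w ->] : exists w : int, width d = gp 0 w.
  by exists (if d then M else N)%:Z; rewrite gp0 /width; case: d.
have := cell_nocross (R := R) w c (leq0n (ex d k)); rewrite !gp0; lra.
Qed.

Lemma region_element (s : bool -> bool) P k c : bisected k c ->
  (forall d, halfin (s d) 0 (width d) (crd d P)) ->
  (forall d, halfin (s d) (region_lo d k c) (region_hi d k c) (crd d P)) ->
  exists k2 c2, [/\ G (cell k2 c2), (k <= k2)%N &
    forall d, halfin (s d) (lo d (cell k2 c2)) (hi d (cell k2 c2)) (crd d P)].
Proof.
move=> [k1 [c1 [GK lt1 in1]]] /(partition_cover hG)[L GL hL] hP.
have [k2 [c2 e]] := partition_cell hG GL; rewrite {}e in GL hL.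
exists k2, c2; split=> //; apply: (partition_graded hG GK lt1 in1 GL) => d.
have := hL d; have := hP d; rewrite /region_lo /region_hi /halfin.
by case: (s d); lra.
Qed.

Lemma grid_on_side d s n k c m : (n <= ex d k)%N ->
  halfin s (lo d (cell k c)) (hi d (cell k c)) (gp n m : R) ->
  on_side d (cell k c) (gp n m : R).
Proof.
move=> /(cell_nocross (R := R) m c) hn hx; rewrite /on_side.
have : gp n m = lo d (cell k c) :> R \/ gp n m = hi d (cell k c) :> R.
  by case: s hx => /= hx; [left|right]; lra.
by [].
Qed.

Lemma halfin_inward (a b a' b' z x : R) : a < z < b -> a' < z < b' ->
  a <= x <= b -> a' <= x <= b' ->
  exists s, halfin s a b x && halfin s a' b' x.
Proof. by move=> *; case: (leP x z) => h; [exists true|exists false] => /=; lra. Qed.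

Lemma region_mid d k c :
  region_lo d k c < gp (ex d k).+1 (2 * c d + 1) < region_hi d k c.
Proof. by rewrite /region_lo /region_hi ![gp (ex d k) _]gpS !gp_lt; lia. Qed.

(** The quadrant at [P] pointing to the midpoint of C stays within B(C) and the domain, so its
    element has level at least [k]. The grid line through [P] cannot cut this element, hence carries
    one of its sides. *)
Lemma grid_Sk d k c P m : bisected k c ->
  crd d P = gp (ex d k) m ->
  (forall d', region_lo d' k c <= crd d' P <= region_hi d' k c) ->
  (forall d', 0 <= crd d' P <= width d') ->
  Sk (~~ d) G P.
Proof.
move=> hC hm hreg hdom.
have hs d' : exists s, halfin s 0 (width d') (crd d' P) &&
    halfin s (region_lo d' k c) (region_hi d' k c) (crd d' P).
  apply: (@halfin_inward _ _ _ _ (gp (ex d' k).+1 (2 * c d' + 1))) => //.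
    have [h1 h2] := bisected_domain d' hC; apply/andP; split.
      by apply: le_lt_trans h1 _; rewrite lo_cell gpS gp_lt; lia.
    by apply: lt_le_trans h2; rewrite hi_cell [ltRHS]gpS gp_lt; lia.
  exact: region_mid.
have [s1 /andP[h1 h1']] := hs true; have [s2 /andP[h2 h2']] := hs false.
have [||k2 [c2 [GL le2 hL]]] :=
  @region_element (fun d' => if d' then s1 else s2) P k c hC; try by case.
apply: (Sk_side (partition_finite hG) GL).
- rewrite negbK hm; have := hL d; rewrite hm.
  by apply: grid_on_side; apply: ex_le.
- exact: lo_hi_cell.
- exact: halfin_closed (hL (~~ d)).
Qed.

Lemma interior_halfin s d P : interior P -> halfin s 0 (width d) (crd d P).
Proof. by move=> /(_ d); case: s => /=; lra. Qed.

(** The side [s] is prescribed in direction [e], so B(C) has to extend beyond [P] on that side;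
    across, the quadrant is free to point inward. *)
Lemma grid_edge e s k c P m : bisected k c -> node G P -> interior P ->
  crd (~~ e) P = gp (ex (~~ e) k) m ->
  region_lo (~~ e) k c <= crd (~~ e) P <= region_hi (~~ e) k c ->
  halfin s (region_lo e k c) (region_hi e k c) (crd e P) ->
  edge_toward e s G P.
Proof.
move=> hC nP iP hm hreg hs.
have [s' hs'] : exists s',
    halfin s' (region_lo (~~ e) k c) (region_hi (~~ e) k c) (crd (~~ e) P).
  have := region_mid (~~ e) k c => h.
  by have [s' /andP[? _]] := halfin_inward h h hreg hreg; exists s'.
have [||k2 [c2 [GL le2 hL]]] :=
    @region_element (fun d => if d == e then s else s') P k c hC.
- by move=> d; apply: interior_halfin.
- by move=> d; case: eqP => [->//|/eqP]; case: d e {hm hreg} hs hs' => -[].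
apply: (edge_toward_side (partition_finite hG) nP GL); last first.
  by have := hL e; rewrite eqxx.
rewrite hm; have := hL (~~ e); rewrite hm; apply: grid_on_side.
exact: ex_le.
Qed.

(** * T-junctions and the range of their extensions *)

Definition Tjunction_toward d s T : Prop :=
  [/\ node G T, interior T, edge_toward d s G T & ~ edge_toward d (~~ s) G T].

Definition index d (v : R) : set R :=
  [set z | 0 <= z <= width d /\ Sk (~~ d) G (pt d z v)].

(** Edge and face extension joined: the number of index intervals is half the degree, rounded down
    on the side [s] of the edge and up on the other. *)
Definition ext_toward d s T P : Prop :=
  let l := if s then uphalf (deg d) else (deg d)./2 in
  let r := if s then (deg d)./2 else uphalf (deg d) in
  crd (~~ d) P = crd (~~ d) T /\
  exists2 i, consecutive_entries (index d (crd (~~ d) T)) l r (crd d T) i &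
    i (- l%:Z) <= crd d P <= i r%:Z.

(** [K] carries the edge at [T], whose line cuts the interior of the element [L] beyond [T]. C is
    the ancestor of [K] whose bisection created the line. If C extended beyond [T], the grading
    would make [L] too fine to be cut. *)
Lemma Tjunction_midline d s T : Tjunction_toward d s T ->
  exists k c, [/\ bisected k c, sd k = ~~ d,
    crd (~~ d) T = gp (ex (~~ d) k).+1 (2 * c (~~ d) + 1) &
    crd d T = gp (ex d k) (if s then c d else c d + 1)].
Proof.
move=> [nT iT /edge_toward_element[K [GK sK hK]] noedge].
have [k1 [c1 eK]] := partition_cell hG GK; rewrite {}eK in GK sK hK.
have [L GL hL] := partition_cover hG
  (fun d' => interior_halfin (if d' == d then ~~ s else true) d' iT).
have [k2 [c2 eL]] := partition_cell hG GL; rewrite {}eL in GL hL.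
have hLd := hL d; rewrite eqxx in hLd; have hLe := hL (~~ d).
have noside : ~ on_side (~~ d) (cell k2 c2) (crd (~~ d) T).
  by move=> h; apply/noedge/(edge_toward_side (partition_finite hG) nT GL h).
have [m hm] : exists m, crd (~~ d) T = gp (ex (~~ d) k1) m.
  by case: sK => ->; rewrite ?lo_cell ?hi_cell; eexists.
(* A line with integer coordinate is a grid line of every level and could not cut [L]. *)
have [[m' e]|[n [m' [ltn e]]]] := @gp_lowest R (ex (~~ d) k1) m.
  case: noside; rewrite hm e; rewrite hm e in hLe.
  exact: grid_on_side hLe.
have [k [lt1 en sk]] := ex_split ltn.
have [c inC] := cell_ancestor (R := R) c1 (ltnW lt1).
rewrite -en in e; have hC : bisected k c by exists k1, c1.
have em : m' = c (~~ d).
  have : gp (ex (~~ d) k) (c (~~ d)) <= (gp (ex (~~ d) k).+1 (2 * m' + 1) : R)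
      <= gp (ex (~~ d) k) (c (~~ d) + 1).
    rewrite -e -hm -lo_cell -hi_cell; have := inC (~~ d).
    by have := lo_hi_cell (R := R) (~~ d) k1 c1; case: sK => ->; lra.
  by rewrite ![gp (ex (~~ d) k) _]gpS !gp_le; lia.
rewrite {}em in e; exists k, c; split=> //; first by rewrite hm.
suff hn : ~ halfin (~~ s) (lo d (cell k c)) (hi d (cell k c)) (crd d T).
  have := inC d; move: hn; rewrite lo_cell hi_cell.
  by case: (s) => /= hn [h1 h2]; apply/eqP; rewrite eq_le; lra.
move=> hT; have ovC : overlap (cell k2 c2 : rect R) (cell k c).
  move=> d'; have [->|ne] := eqVneq d' d.
    by move: hT hLd; rewrite /halfin; case: (s) => /=; lra.
  have {ne}-> : d' = ~~ d by move: ne; case: (d'); case: (d).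
  have : lo (~~ d) (cell k c) < crd (~~ d) T < hi (~~ d) (cell k c).
    by rewrite hm e lo_cell hi_cell ![gp (ex (~~ d) k) _]gpS !gp_lt; lia.
  by have := halfin_closed hLe; lra.
have le2 : (k <= k2)%N.
  apply: (partition_graded hG GK lt1 inC GL) => d'.
  have := ovC d'; rewrite [lo _ (cell k c)]lo_cell [hi _ (cell k c)]hi_cell.
  move=> [h1 h2]; split; [apply: lt_le_trans h1 _ | apply: le_lt_trans h2].
    by rewrite gp_le; lia.
  by rewrite gp_le; lia.
have {le2} lt2 : (k < k2)%N.
  rewrite ltn_neqAle le2 andbT; apply/eqP => ek; rewrite -{}ek in GL ovC.
  have eC := cell_overlap_eq ovC; rewrite -eC in inC.
  have eK : cell k1 c1 = cell k c2 :> rect R.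
    apply: (partition_disjoint hG GK GL); apply: inside_overlap => // d'.
    exact: lo_hi_cell.
  by move: lt1; rewrite (level_inj eK) ltnn.
apply: noside; rewrite hm e; rewrite hm e in hLe.
apply: grid_on_side hLe; have := ex_le (~~ d) lt2.
by rewrite exS sk eqxx addn1.
Qed.

Lemma uphalf_deg d : (0 < uphalf (deg d))%N.
Proof. by have := deg_ge2 hp hq d; lia. Qed.

Lemma half_deg d : (0 < (deg d)./2)%N.
Proof. by have := deg_ge2 hp hq d; lia. Qed.

(** As C is not bisected in direction [d], B(C) reaches half the degree, rounded up, in cells.
    Within the domain all its grid lines belong to the index set, so index intervals are at most one
    cell long, and both halves of the extension fit when counted from an end of C. *)
Lemma ext_region d s T P k c : bisected k c -> sd k = ~~ d -> interior T ->
  crd (~~ d) T = gp (ex (~~ d) k).+1 (2 * c (~~ d) + 1) ->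
  crd d T = gp (ex d k) (if s then c d else c d + 1) ->
  ext_toward d s T P ->
  region_lo d k c <= crd d P <= region_hi d k c.
Proof.
move=> hC sk iT hmid hT [_ [i]]; set l := (X in consecutive_entries _ X).
set r := (X in consecutive_entries _ _ X); set m0 := (if s then _ else _) in hT.
rewrite -/l -/r => hi_ hP.
have rd : reach d k = uphalf (deg d) by rewrite /reach sk; case: (d).
have [l0 r0] : (0 < l)%N /\ (0 < r)%N.
  by rewrite /l /r; case: (s); rewrite uphalf_deg half_deg.
have lb : c d - (reach d k)%:Z <= m0 - l%:Z.
  by rewrite rd /m0 /l; case: (s); lia.
have rb : m0 + r%:Z <= c d + 1 + (reach d k)%:Z.
  by rewrite rd /m0 /r; case: (s); lia.
have hS (m : int) : m0 - l%:Z <= m <= m0 + r%:Z ->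
    0 <= (gp (ex d k) m : R) <= width d ->
    index d (crd (~~ d) T) (gp (ex d k) m).
  move=> hm hdom; split=> //; apply: (@grid_Sk d k c _ m hC); first exact: crd_pt.
    move=> d'; have [->|ne] := eqVneq d' d.
      by rewrite crd_pt /region_lo /region_hi !gp_le; lia.
    have -> : d' = ~~ d by move: ne; case: (d'); case: (d).
    by rewrite crdN_pt hmid; have := region_mid (~~ d) k c; lra.
  move=> d'; have [->|ne] := eqVneq d' d; first by rewrite crd_pt.
  have -> : d' = ~~ d by move: ne; case: (d'); case: (d).
  by rewrite crdN_pt; have := iT (~~ d); lra.
have iTd := iT d; rewrite hT in iTd.
have /andP[T0 Tw] := iTd.
clearbody l r m0; have up : i r%:Z <= gp (ex d k) (m0 + r%:Z).
  have := @consecutive_le_grid R _ l r _ i (ex d k) (m0 + 1) (width d) hi_.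
  move=> /(_ _ _ _ r.-1); rewrite prednK //.
  have -> : m0 + 1 + r.-1%:Z = m0 + r%:Z by clear -r0; lia.
  apply; [by move=> z [/andP[]] | by rewrite hT gp_lt ltrDl | |
          by clear -r0; lia].
  move=> j hj hw; apply: hS; first by clear -hj; lia.
  rewrite hw andbT; apply: le_trans (ltW T0) _.
  by rewrite gp_le; clear; lia.
have dn : gp (ex d k) (m0 - l%:Z) <= i (- l%:Z).
  have := @consecutive_ge_grid R _ l r _ i (ex d k) (m0 - 1) hi_.
  move=> /(_ _ _ _ l.-1); rewrite prednK //.
  have -> : m0 - 1 - l.-1%:Z = m0 - l%:Z by clear -l0; lia.
  apply; [by move=> z [/andP[]] | by rewrite hT gp_lt gtrBl | |
          by clear -l0; lia].
  move=> j hj hw; apply: hS; first by clear -hj; lia.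
  rewrite hw /=; apply: le_trans (ltW Tw).
  by rewrite gp_le; clear; lia.
move: lb rb; rewrite -!(@gp_le R (ex d k)) /region_lo /region_hi; lra.
Qed.

(** If B(C) extended around [T] on the side of the missing edge, the grid line through [T] would
    supply that edge. So [T] is further out, and the grid lines of B(C) between [T] and the midline
    of C use up all entries of the extension. *)
Lemma ext_misses_midline e s T P k c m : bisected k c -> sd k = e ->
  Tjunction_toward e s T -> ext_toward e s T P ->
  crd (~~ e) T = gp (ex (~~ e) k) m ->
  region_lo (~~ e) k c <= crd (~~ e) T <= region_hi (~~ e) k c ->
  crd e P <> gp (ex e k).+1 (2 * c e + 1).
Proof.
move=> hC sk [nT iT _ noedge] [_ [i]]; set l := (X in consecutive_entries _ X).
set r := (X in consecutive_entries _ _ X).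
rewrite -/l -/r => hi_ hP hm hreg eP; rewrite {}eP in hP.
have out : ~ halfin (~~ s) (region_lo e k c) (region_hi e k c) (crd e T).
  by move=> h; apply: noedge; apply: (grid_edge hC nT iT hm hreg h).
have hS (m' : int) :
    c e - (reach e k)%:Z <= m' <= c e + 1 + (reach e k)%:Z ->
    0 <= (gp (ex e k) m' : R) <= width e ->
    index e (crd (~~ e) T) (gp (ex e k) m').
  move=> hm' hdom; split=> //.
  apply: (@grid_Sk e k c _ m' hC); first exact: crd_pt.
    move=> d'; have [->|ne] := eqVneq d' e.
      by rewrite crd_pt /region_lo /region_hi !gp_le.
    have -> : d' = ~~ e by move: ne; case: (d'); case: (e).
    by rewrite crdN_pt.
  move=> d'; have [->|ne] := eqVneq d' e; first by rewrite crd_pt.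
  have -> : d' = ~~ e by move: ne; case: (d'); case: (e).
  by rewrite crdN_pt; have := iT (~~ e); lra.
have /andP[T0 Tw] := iT e.
(* C is bisected in direction [e], so its reach is half the degree rounded down: the count on the
   edge side. The other count is at most one more. *)
have lr : if s then r = reach e k /\ (l <= (reach e k).+1)%N
          else l = reach e k /\ (r <= (reach e k).+1)%N.
  by rewrite /l /r /reach sk eqxx; case: (s); split=> //; clear; lia.
have [l0 r0] : (0 < l)%N /\ (0 < r)%N.
  by rewrite /l /r; case: (s); rewrite uphalf_deg half_deg.
move: hS out lr; rewrite /region_lo /region_hi => hS out lr.
clearbody l r; move: (reach e k) hS out lr {hreg} => b hS out lr.
have [lb rb] : (l <= b.+1)%N /\ (r <= b.+1)%N.
  by move: lr; clear; case: (s) => -[]; lia.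
have below (m' : int) : c e - b%:Z <= m' -> m' + r%:Z <= c e + 1 ->
    crd e T < gp (ex e k) m' -> False.
  move=> h1 h2 h3.
  have := @consecutive_le_grid R _ l r _ i (ex e k) m' (width e) hi_.
  move=> /(_ _ h3 _ r.-1); rewrite prednK // => h.
  have {h}: i r%:Z <= gp (ex e k) (m' + r.-1%:Z).
    apply: h; [by move=> z [/andP[]]| |by clear -r0; lia].
    move=> j hj hw; apply: hS; first by clear -h1 h2 hj; lia.
    rewrite hw andbT; apply/ltW/(lt_le_trans T0)/(le_trans (ltW h3)).
    by rewrite gp_le lerDl.
  have : gp (ex e k) (m' + r.-1%:Z) < gp (ex e k).+1 (2 * c e + 1) :> R.
    by rewrite gpS gp_lt; clear -h2 r0; lia.
  by move: hP; clear; lra.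
have above (m' : int) : m' <= c e + 1 + b%:Z -> c e <= m' - l%:Z ->
    gp (ex e k) m' < crd e T -> False.
  move=> h1 h2 h3.
  have := @consecutive_ge_grid R _ l r _ i (ex e k) m' hi_.
  move=> /(_ _ h3 _ l.-1); rewrite prednK // => h.
  have {h}: gp (ex e k) (m' - l.-1%:Z) <= i (- l%:Z).
    apply: h; [by move=> z [/andP[]]| |by clear -l0; lia].
    move=> j hj hw; apply: hS; first by clear -h1 h2 hj; lia.
    rewrite hw /=; apply/ltW/(le_lt_trans _ Tw)/(le_trans _ (ltW h3)).
    by rewrite gp_le gerBl.
  have : gp (ex e k).+1 (2 * c e + 1) < gp (ex e k) (m' - l.-1%:Z) :> R.
    by rewrite [ltRHS]gpS gp_lt; clear -h2 l0; lia.
  by move: hP; clear; lra.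
case: s lr out {noedge} => -[lr1 lr2] /= out.
(* When the edge side faces C, [T] may lie on the end of B(C), and [b] grid lines remain; when the
   face side does, [T] is strictly outside and there are [b.+1]. *)
- have [h|h] := lerP (crd e T) (gp (ex e k) (c e - b%:Z)).
    apply: (below (c e - b%:Z + 1)); try by clear -lr1; lia.
    by apply: le_lt_trans h _; rewrite gp_lt ltrDl.
  apply: (above (c e + 1 + b%:Z)); try by clear -lr2; lia.
  by rewrite ltNge; apply/negP => h'; apply: out; rewrite h.
- have [h|h] := ltrP (crd e T) (gp (ex e k) (c e - b%:Z)).
    by apply: below h; clear -lr2; lia.
  apply: (above (c e + b%:Z)); try by clear -lr1; lia.
  rewrite ltNge; apply/negP => h'; apply: out; rewrite h /=.
  by apply: le_lt_trans h' _; rewrite gp_lt; clear; lia.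
Qed.

(** The line of [T2], midline of a coarser cell, is a grid line of level [k1]. It passes through
    [P], which lies in B(C1) by [ext_region] and on the midline of C1, where the extension of [T2]
    cannot be. *)
Lemma ext_disjoint_finer e s1 s2 T1 T2 P k1 c1 k2 c2 :
  Tjunction_toward (~~ e) s1 T1 -> Tjunction_toward e s2 T2 ->
  bisected k1 c1 -> sd k1 = e ->
  crd e T1 = gp (ex e k1).+1 (2 * c1 e + 1) ->
  crd (~~ e) T1 = gp (ex (~~ e) k1) (if s1 then c1 (~~ e) else c1 (~~ e) + 1) ->
  sd k2 = ~~ e -> crd (~~ e) T2 = gp (ex (~~ e) k2).+1 (2 * c2 (~~ e) + 1) ->
  (k2 < k1)%N -> ext_toward (~~ e) s1 T1 P -> ~ ext_toward e s2 T2 P.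
Proof.
move=> hT1 hT2 hC1 sk1 mid1 end1 sk2 mid2 lt21 ext1 ext2.
have [_ iT1 _ _] := hT1.
have := ex_le (~~ e) lt21; rewrite exS sk2 eqxx addn1 => le21.
have [m hm] := gp_refine (R := R) (2 * c2 (~~ e) + 1) le21.
have := ext_region hC1 _ iT1 _ end1 ext1; rewrite negbK => /(_ sk1 mid1).
have [-> _] := ext2 => hreg; rewrite hm in mid2.
apply: (ext_misses_midline hC1 sk1 hT2 ext2 mid2 hreg).
by have [] := ext1; rewrite negbK => ->.
Qed.

Lemma ext_disjoint s1 s2 T1 T2 P :
  Tjunction_toward true s1 T1 -> Tjunction_toward false s2 T2 ->
  ext_toward true s1 T1 P -> ~ ext_toward false s2 T2 P.
Proof.
move=> h1 h2 e1 e2.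
have [k1 [c1 [hC1 sk1 mid1 end1]]] := Tjunction_midline h1.
have [k2 [c2 [hC2 sk2 mid2 end2]]] := Tjunction_midline h2.
have [lt21|lt12|e12] := ltngtP k2 k1.
- exact: (@ext_disjoint_finer false _ _ _ _ _ _ _ _ _
    h1 h2 hC1 sk1 mid1 end1 sk2 mid2 lt21 e1 e2).
- exact: (@ext_disjoint_finer true _ _ _ _ _ _ _ _ _
    h2 h1 hC2 sk2 mid2 end2 sk1 mid1 lt12 e2 e1).
(* Equal levels would mean equal directions of bisection. *)
- by move: sk1; rewrite -e12 sk2.
Qed.

(** * From the four types of T-junctions to directions and sides *)

Definition positive (tau : Ttype) : bool :=
  match tau with Tright | Tup => true | Tleft | Tdown => false end.

(** Active nodes are interior, as the margin of the active region is at least 1, and a fourth edge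
    would contradict valence three. *)
Lemma Tjunction_towardP T tau : Tjunction p q M N G T tau ->
  Tjunction_toward (horizontal tau) (positive tau) T.
Proof.
move=> [[nT [/andP[h1 h2] /andP[h3 h4]]] val hT].
have hedges : [/\ edge_toward (horizontal tau) (positive tau) G T,
    edge_toward (~~ horizontal tau) true G T &
    edge_toward (~~ horizontal tau) false G T].
  by case: tau hT => -[].
have [e1 e2 e3] := hedges; split=> //.
  have up1 n : (2 <= n)%N -> 1 <= (uphalf n)%:R :> R by move=> h; rewrite ler1n; lia.
  by have := up1 _ hp; have := up1 _ hq; move=> hq' hp'; case=> /=; lra.
move=> e4; apply: (valence_three val) => d s.
have [->|] := eqVneq d (horizontal tau).
  by have [->|] := eqVneq s (positive tau); first exact: e1;
    case: s; case: (positive tau) e4.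
by case: d; case: (horizontal tau) e2 e3 => // e2 e3 _; case: s.
Qed.

Lemma extP T tau P : ext p q M N G T tau P ->
  ext_toward (horizontal tau) (positive tau) T P.
Proof.
rewrite /ext /ext_e /ext_f /ext_toward; case: tau => /= -[] [-> [i hi_ hP]];
  split=> //; exists i => //; have := consecutive_ge hi_;
  have := consecutive_le hi_; move: (hi_) hP => [-> _ _]; rewrite /deg /crd /=; lra.
Qed.

End Crossing.

Theorem theorem3p6 (R : realType) (p q M N : nat)
  (hp : (2 <= p)%N) (hq : (2 <= q)%N) (hM : (0 < M)%N) (hN : (0 < N)%N)
  (G : mesh R) (hG : admissible p q M N G) :
  analysis_suitable p q M N G.
Proof.
move=> T1 T2 tau1 tau2 hT1 h1 hT2 h2; apply/seteqP; split=> // P [].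
move=> /(extP (p := p)) e1 /(extP (p := p)) e2.
have hgr := admissible_graded hp hq hG.
move/(Tjunction_towardP hp hq): hT1 => hT1.
move/(Tjunction_towardP hp hq): hT2 => hT2.
rewrite (negPf h2) in hT2 e2; rewrite h1 in hT1 e1.
exact: ext_disjoint hgr _ _ _ _ _ hT1 hT2 e1 e2.
Qed.
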